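(* Let $\mathcal{A}$ be a normed algebra and $\mathcal{I}$ be a closed ideal of $\mathcal{A}$. If $N(\mathcal{A} \times_c \mathcal{I})$ is a singleton, then $N(\mathcal{A})$ is a singleton.
   Context: Algebras are associative algebras over $\mathbb{C}$ (not assumed unital or commutative); ideals are two-sided. An algebra norm on an algebra $\mathcal{A}$ is a vector space norm $\|\cdot\|$ on $\mathcal{A}$ that is submultiplicative, i.e. $\|ab\| \le \|a\|\|b\|$ for all $a,b \in \mathcal{A}$ (completeness is not required); a normed algebra is an algebra with an algebra norm. $N(\mathcal{A})$ denotes the set of equivalence classes of all algebra norms on $\mathcal{A}$, where two norms are identified if they are equivalent (induce the same topology). For an algebra $\mathcal{A}$ and an ideal $\mathcal{I}$ of $\mathcal{A}$, the convolution product algebra $\mathcal{A} \times_c \mathcal{I}$ is the vector space $\mathcal{A} \times \mathcal{I}$ with coordinatewise linear operations and the product $(a,x) \times_c (b,y) = (ab + xy, ay + xb)$. *)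

(* Defs.v *)
From HB Require Import structures.
From mathcomp Require Import all_boot all_order all_algebra.
From mathcomp Require Import complex.
From mathcomp Require Import all_classical all_reals all_analysis.

Set Implicit Arguments.
Unset Strict Implicit.
Unset Printing Implicit Defensive.

Import Order.TTheory GRing.Theory Num.Theory.
Import numFieldNormedType.Exports.

Local Open Scope classical_set_scope.
Local Open Scope ring_scope.
Local Open Scope complex_scope.

(* The library's [algType K] has a unit element; [nuAlgType K] does not require
   one. *)
HB.mixin Record Lmodule_isNuAlgebra (K : pzRingType) A & GRing.Lmodule K A := {
  nmul : A -> A -> A;
  nmulA : associative nmul;
  nmulDl : left_distributive nmul +%R;
  nmulDr : right_distributive nmul +%R;
  nscalerAl : forall (c : K) (a b : A), c *: nmul a b = nmul (c *: a) b;
  nscalerAr : forall (c : K) (a b : A), c *: nmul a b = nmul a (c *: b)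
}.

#[short(type="nuAlgType")]
HB.structure Definition NuAlgebra (K : pzRingType) :=
  {A of Lmodule_isNuAlgebra K A & GRing.Lmodule K A}.

Reserved Notation "a ** b" (at level 40, left associativity).
Notation "a ** b" := (nmul a b) : ring_scope.

HB.mixin Record isNuIdeal (K : pzRingType) (A : nuAlgType K) (S : {pred A}) := {
  nideal_mull : forall a x : A, x \in S -> a ** x \in S;
  nideal_mulr : forall a x : A, x \in S -> x ** a \in S
}.

#[short(type="nuIdeal")]
HB.structure Definition NuIdeal (K : pzRingType) (A : nuAlgType K) :=
  {S of GRing.AddClosed A S & GRing.isScaleClosed K A S & isNuIdeal K A S}.

Section Convolution.
Context {K : pzRingType} {A : nuAlgType K} (I : nuIdeal A).

Definition ideal_sort : Type := {x : A | x \in I}.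
HB.instance Definition _ := [isSub of ideal_sort for @sval A _].
HB.instance Definition _ := [Choice of ideal_sort by <:].
HB.instance Definition _ := [SubChoice_isSubLmodule of ideal_sort by <:].

Definition ideal_lact (a : A) (x : ideal_sort) : ideal_sort :=
  exist _ (a ** val x) (nideal_mull a _ (valP x)).
Definition ideal_ract (x : ideal_sort) (a : A) : ideal_sort :=
  exist _ (val x ** a) (nideal_mulr a _ (valP x)).

Definition conv : Type := (A * ideal_sort)%type.
HB.instance Definition _ := GRing.Lmodule.copy conv (A * ideal_sort)%type.

Definition conv_mul (u v : conv) : conv :=
  (u.1 ** v.1 + val u.2 ** val v.2,
   ideal_lact u.1 v.2 + ideal_ract u.2 v.1).

Lemma conv_mulA : associative conv_mul.
Proof.
move=> [a x] [b y] [c z]; congr pair => /=; last apply: val_inj => /=;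
  by rewrite !nmulDl !nmulDr !nmulA -!addrA; congr (_ + _); rewrite addrA addrC.
Qed.

Lemma conv_mulDl : left_distributive conv_mul +%R.
Proof.
move=> [a x] [b y] [c z]; congr pair => /=; first by rewrite !nmulDl addrACA.
by apply: val_inj => /=; rewrite !nmulDl addrACA.
Qed.

Lemma conv_mulDr : right_distributive conv_mul +%R.
Proof.
move=> [a x] [b y] [c z]; congr pair => /=; first by rewrite !nmulDr addrACA.
by apply: val_inj => /=; rewrite !nmulDr addrACA.
Qed.

Lemma conv_scalerAl c (u v : conv) :
  c *: conv_mul u v = conv_mul (c *: u) v.
Proof.
case: u v => [a x] [b y]; congr pair => /=.
  by rewrite scalerDr !nscalerAl.
by apply: val_inj => /=; rewrite scalerDr !nscalerAl.
Qed.

Lemma conv_scalerAr c (u v : conv) :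
  c *: conv_mul u v = conv_mul u (c *: v).
Proof.
case: u v => [a x] [b y]; congr pair => /=.
  by rewrite scalerDr !nscalerAr.
by apply: val_inj => /=; rewrite scalerDr !nscalerAr.
Qed.

HB.instance Definition _ := Lmodule_isNuAlgebra.Build K conv
  conv_mulA conv_mulDl conv_mulDr conv_scalerAl conv_scalerAr.

End Convolution.

Notation "A '\x_c' I" := (@conv _ A I) (at level 40) : type_scope.

(* [Normc.normc c : R] is the modulus of [c : R[i]].  Nonnegativity of
   the norm follows from the axioms. *)
Record algNorm (R : realType) (A : nuAlgType R[i]) := AlgNorm {
  algnorm :> A -> R;
  algnormD : forall a b, algnorm (a + b) <= algnorm a + algnorm b;
  algnormZ : forall c a, algnorm (c *: a) = Normc.normc c * algnorm a;
  algnorm_eq0 : forall a, algnorm a = 0 -> a = 0;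
  algnormM : forall a b, algnorm (a ** b) <= algnorm a * algnorm b
}.

Section NormTopology.
Context {R : realType} {A : nuAlgType R[i]}.

(* An alias of [A] carrying the normed module structure over [R[i]], hence the
   topology, given by [p]; the library's norms on such modules take their
   values in [R[i]]. *)
Definition normedBy (p : algNorm A) : Type := A.

Section Instances.
Variable p : algNorm A.
HB.instance Definition _ := GRing.Lmodule.on (normedBy p).

Definition cnorm (a : normedBy p) : R[i] := (p a)%:C.

Lemma cnormD (a b : normedBy p) : cnorm (a + b) <= cnorm a + cnorm b.
Proof. by rewrite /cnorm -rmorphD lecR algnormD. Qed.

Lemma cnormZ (c : R[i]) (a : normedBy p) : cnorm (c *: a) = `|c| * cnorm a.
Proof. by rewrite /cnorm algnormZ rmorphM; case: c. Qed.

Lemma cnorm_eq0 (a : normedBy p) : cnorm a = 0 -> a = 0.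
Proof. by case=> /algnorm_eq0. Qed.

HB.instance Definition _ :=
  Lmodule_isNormed.Build R[i] (normedBy p) cnormD cnormZ cnorm_eq0.
End Instances.

Definition same_topology (p q : algNorm A) : Prop :=
  forall U : set A, @open (normedBy p) U <-> @open (normedBy q) U.

Definition norm_class (p : algNorm A) : set (algNorm A) :=
  [set q | same_topology p q].

End NormTopology.

Definition normClasses (R : realType) (A : nuAlgType R[i]) :
  set (set (algNorm A)) := range (@norm_class R A).
Arguments normClasses {R} A.

Definition is_singleton (T : Type) (S : set T) : Prop := exists x, S = [set x].

(* Main.v *)
Require Import Defs.
From mathcomp Require Import all_boot all_order all_algebra.
From mathcomp Require Import complex.
From mathcomp Require Import all_classical all_reals all_analysis.

Import Order.TTheory GRing.Theory Num.Theory.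

Local Open Scope ring_scope.
Local Open Scope complex_scope.
Local Open Scope classical_set_scope.

(** Every algebra norm [q] on [A] extends to the algebra norm
    [(a, x) |-> q a + q x] on the convolution product.  The embedding
    [a |-> (a, 0)] is isometric and the projection [(a, x) |-> a] is
    nonexpansive for these norms, so the topology of [q] is determined by that
    of its extension. *)

Lemma algnorm0 {R : realType} {A : nuAlgType R[i]} (q : algNorm A) : q 0 = 0.
Proof. by rewrite -(scale0r 0) algnormZ Normc.normc0 mul0r. Qed.

Lemma algnorm_ge0 {R : realType} {A : nuAlgType R[i]} (q : algNorm A) (a : A) :
  0 <= q a.
(* The norm of [normedBy q] is [q] viewed in [R[i]], so its nonnegativity transfers. *)
Proof. by have := normr_ge0 (a : normedBy q); rewrite lecR. Qed.

Section ConvNorm.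
Context {R : realType} {A : nuAlgType R[i]} (I : nuIdeal A) (q : algNorm A).

Definition conv_norm_fun (u : A \x_c I) : R := q u.1 + q (val u.2).

Lemma conv_normD (u v : A \x_c I) :
  conv_norm_fun (u + v) <= conv_norm_fun u + conv_norm_fun v.
Proof. by rewrite /conv_norm_fun addrACA lerD ?algnormD. Qed.

Lemma conv_normZ (c : R[i]) (u : A \x_c I) :
  conv_norm_fun (c *: u) = Normc.normc c * conv_norm_fun u.
Proof. by rewrite /conv_norm_fun mulrDr -!algnormZ. Qed.

Lemma conv_norm_eq0 (u : A \x_c I) : conv_norm_fun u = 0 -> u = 0.
Proof.
case: u => a x /eqP.
rewrite paddr_eq0 ?algnorm_ge0// => /andP[/eqP/algnorm_eq0 /= -> /eqP].
by move=> /algnorm_eq0 /= x0; congr pair; apply: val_inj.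
Qed.

(** Expanding [(q a + q x) * (q b + q y)] gives four terms, which bound the norms of [ab], [xy],
    [ay] and [xb] respectively. *)
Lemma conv_normM (u v : A \x_c I) :
  conv_norm_fun (u ** v) <= conv_norm_fun u * conv_norm_fun v.
Proof.
case: u v => [a x] [b y]; rewrite /conv_norm_fun /=.
(* Regroup the four terms by coordinate: those for [ab + xy] first, then those for [ay + xb]. *)
rewrite mulrDl !mulrDr [q (val x) * _ + _]addrC addrACA.
by rewrite lerD// (le_trans (algnormD _ _ _))// lerD// algnormM.
Qed.

Definition conv_norm : algNorm (A \x_c I) :=
  AlgNorm conv_normD conv_normZ conv_norm_eq0 conv_normM.

End ConvNorm.

Lemma open_preimage_nonexpansive {R : realType} {A B : nuAlgType R[i]}
    (p : algNorm A) (q : algNorm B) (f : A -> B) (U : set B) :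
  (forall a b, q (f a - f b) <= p (a - b)) ->
  @open (normedBy q) U -> @open (normedBy p) (f @^-1` U).
Proof.
move=> fpq; suff fc : continuous (f : normedBy p -> normedBy q).
  by apply: open_comp => a _; exact: fc.
move=> a; apply/(cvgrPdist_lt (FF := @nbhs_filter (normedBy p) a)) => e e0.
(* Since [f] does not increase distances, the radius [e] itself serves as the delta. *)
apply/nbhs_normP; exists e => //= b.
by apply: le_lt_trans; rewrite lecR fpq.
Qed.

Lemma open_conv_norm {R : realType} {A : nuAlgType R[i]} (I : nuIdeal A)
    (q : algNorm A) (U : set A) :
  @open (normedBy (conv_norm I q)) (fst @^-1` U) <-> @open (normedBy q) U.
Proof.
split; last first.
  apply: open_preimage_nonexpansive => u v.
  by rewrite lerDl algnorm_ge0.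
apply: (@open_preimage_nonexpansive _ _ _ _ _ (fun a => (a, 0) : A \x_c I)).
by move=> a b; rewrite /= /conv_norm_fun /= subr0 algnorm0 addr0.
Qed.

Theorem lemma2p9 (R : realType) (A : nuAlgType R[i]) (p : algNorm A)
  (I : nuIdeal A) (closedI : @closed (normedBy p) [set` I]) :
  is_singleton (normClasses (A \x_c I)) -> is_singleton (normClasses A).
Proof.
move=> [C CE]; have classE Q : norm_class Q = C.
  suff : normClasses (A \x_c I) (norm_class Q) by rewrite CE.
  by exists Q.
have same (q1 q2 : algNorm A) : same_topology q1 q2.
  have Q12 : norm_class (conv_norm I q1) (conv_norm I q2).
    (* Both extensions have class [C], and the extension of [q2] lies in its own class by
       reflexivity. *)
    by rewrite classE -(classE (conv_norm I q2)) => U.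
  by move=> U; rewrite -!(open_conv_norm I); exact: Q12.
(* By [same], every class consists of all norms on [A], so there is at most one; [p] ensures that
   there is one. *)
exists (norm_class p); apply/seteqP; split=> [_ [q _ <-]|_ ->].
  by apply/seteqP; split=> r _; exact: same.
by exists p.
Qed.
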